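(* Let $p$ be a prime such that $p\ne 2$, $p\ne 3$, and $p\ne 5$. If $i$ is a Lucas zero with respect to $p$, then $\lvert L(i)\rvert_p = \lvert F(p-\epsilon)\rvert_p$.
   Context: $F(n)_{n\ge 0}$ is the Fibonacci sequence: $F(0)=0$, $F(1)=1$, $F(n+2)=F(n+1)+F(n)$. $L(n)_{n\ge 0}$ is the Lucas sequence: $L(0)=2$, $L(1)=1$, $L(n+2)=L(n+1)+L(n)$. $\lvert\cdot\rvert_p$ is the $p$-adic absolute value. For a prime $p\ne 5$, $\epsilon = 1$ if $p\equiv 1,4 \pmod 5$ and $\epsilon=-1$ if $p\equiv 2,3\pmod 5$. $\pi(p)$ is the smallest integer $m \ge 1$ such that $F(n+m)\equiv F(n) \pmod p$ for all $n\ge 0$. An integer $i \in \{0,1,\dots,\pi(p)-1\}$ is a Lucas zero with respect to $p$ if $L(i)\equiv 0 \pmod p$. *)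

(* Defs.v *)
From mathcomp Require Import all_boot all_order all_algebra.

Set Implicit Arguments.
Unset Strict Implicit.
Unset Printing Implicit Defensive.

Import Order.TTheory GRing.Theory Num.Theory.

Fixpoint fib (n : nat) : nat :=
  match n with
  | 0 => 0
  | 1 => 1
  | (m.+1 as k).+1 => fib k + fib m
  end.

Fixpoint lucas (n : nat) : nat :=
  match n with
  | 0 => 2
  | 1 => 1
  | (m.+1 as k).+1 => lucas k + lucas m
  end.

(* |x|_p = p ^ (- v_p(x)) with v_p(x) = v_p(numerator) - v_p(denominator).
   All values are rational, so rat serves as codomain. The case x = 0 is
   separate because logn p 0 = 0. *)
Definition padic_abs (p : nat) (x : rat) : rat :=
  (if x == 0 then 0
   else p%:R ^ ((logn p `|denq x|%N)%:Z - (logn p `|numq x|%N)%:Z))%R.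

(* The value 0 is a default for multiples of 5. *)
Definition epsilon (p : nat) : int :=
  (if (p %% 5)%N \in [:: 1; 4]%N then 1
   else if (p %% 5)%N \in [:: 2; 3]%N then -1
   else 0)%R.

Definition fib_period (p m : nat) : Prop :=
  0 < m /\ forall n, fib (n + m) = fib n %[mod p].

(* The graph of pi: pisano p m means pi(p) = m. *)
Definition pisano (p m : nat) : Prop :=
  fib_period p m /\ forall m', fib_period p m' -> m <= m'.

Definition lucas_zero (p i : nat) : Prop :=
  exists m, [/\ pisano p m, i < m & lucas i = 0 %[mod p]].

Lemma pisano_unique (p m1 m2 : nat) : pisano p m1 -> pisano p m2 -> m1 = m2.
Proof.
move=> [P1 min1] [P2 min2].
by apply/eqP; rewrite eqn_leq min1 // min2.
Qed.

Lemma pisano_exists (p : nat) : 0 < p -> exists m, pisano p m.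
Proof.
case: p => // q _.
pose s (x : 'I_q.+1 * 'I_q.+1) := (x.2, (x.2 + x.1)%R).
have s_inj : injective s.
  move=> [a b] [c d] e; have /= bd := congr1 fst e.
  by have /= := congr1 snd e; rewrite bd => /addrI ->.
pose x0 : 'I_q.+1 * 'I_q.+1 := (inZp 0, inZp 1).
have iterE n : iter n s x0 = (inZp (fib n), inZp (fib n.+1)).
  elim: n => // n IHn; rewrite iterS IHn /s /=; congr pair.
  by apply/val_inj; rewrite /= modnDm.
pose P m := (0 < m) && (iter m s x0 == x0).
have exP : exists m, P m.
  by exists (order s x0); rewrite /P order_gt0 iter_order /=.
have PE m : fib_period q.+1 m <-> P m.
  split=> [[m_gt0 per] | /andP[m_gt0 /eqP itm]].
    rewrite /P m_gt0 iterE /=; apply/eqP; congr pair; apply/val_inj.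
      exact: (per 0).
    exact: (per 1).
  split=> // n; have := iterE (n + m).
  by rewrite iterD itm iterE => -[].
exists (ex_minn exP); case: ex_minnP => m Pm minm.
by split=> [|m' /PE]; [apply/PE | apply: minm].
Qed.

(* Main.v *)
(** Write N = p - epsilon.  Let z be a primitive fifth root of unity in a field
    of order p^4: the roots of X^2 - X - 1 are - (z + z^4) and - (z^2 + z^3),
    and Frobenius fixes or exchanges them according to p mod 5, whence p
    divides F(N) by Binet's formula.  If p divides L(i), then p does not divide
    F(i), so L(i) and F(2i) = F(i) L(i) have the same valuation.  Put
    g = gcd(2i, N), which is even; p divides F(g).  Since F(gk) / F(g) is
    congruent to k F(g+1)^(k-1) mod p, F(gk) and F(g) have the same valuation
    when p does not divide k.  This applies to N = gk, and to 2i = gk because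
    2g is a period mod p, so that i < 2g and k < 4. *)
Require Import Defs.
From mathcomp Require Import all_boot all_order all_algebra.
From mathcomp Require Import all_fingroup all_solvable all_field.
From mathcomp Require Import zify ring.

Set Implicit Arguments.
Unset Strict Implicit.
Unset Printing Implicit Defensive.

Import GRing.Theory.

(** * Identities between Fibonacci and Lucas numbers *)

Lemma fibSS n : fib n.+2 = fib n.+1 + fib n. Proof. by []. Qed.

Lemma lucasSS n : lucas n.+2 = lucas n.+1 + lucas n. Proof. by []. Qed.

Lemma fib_gt0 n : 0 < n -> 0 < fib n.
Proof.
case: n => // n _; elim: n => // n IHn.
by rewrite fibSS ltn_addr.
Qed.

Lemma fib_addS m n :
  fib (m + n).+1 = fib m.+1 * fib n.+1 + fib m * fib n.
Proof.
elim: m n => [|m IHm] n; first by rewrite add0n mul1n mul0n addn0.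
by rewrite addSnnS IHm !fibSS; ring.
Qed.

(** This is L(n) = F(n+1) + F(n-1) with F(n) added on both sides, so that no predecessor occurs and
    n = 0 is covered. *)
Lemma lucas_add_fib n : lucas n + fib n = 2 * fib n.+1.
Proof.
suff: lucas n + fib n = 2 * fib n.+1 /\ lucas n.+1 + fib n.+1 = 2 * fib n.+2.
  by case.
elim: n => // n [IH1 IH2]; split=> //.
by rewrite lucasSS (fibSS n.+1) mulnDr -IH2 (fibSS n) -IH1; ring.
Qed.

Lemma fib_double n : fib (n + n) = fib n * lucas n.
Proof.
case: n => // n; rewrite addSn fib_addS.
have := lucas_add_fib n.+1; rewrite fibSS; nia.
Qed.

Lemma fib_cassini (R : comPzRingType) n :
  ((fib n.+1)%:R ^+ 2 - (fib n.+1)%:R * (fib n)%:R - (fib n)%:R ^+ 2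
     = (- 1) ^+ n :> R)%R.
Proof.
elim: n => [|n IHn]; first by rewrite /= expr0; ring.
by rewrite fibSS [RHS]exprS -IHn !natrD; ring.
Qed.

(** * Divisibility and periodicity of Fibonacci numbers modulo p *)

Section FibModulo.

Variables (p : nat) (p_prime : prime p).

Let natFp0 n : ((n%:R : 'F_p) == 0)%R = (p %| n).
Proof. by rewrite (dvdn_pcharf (pchar_Fp p_prime)). Qed.

Lemma dvdn_fibS n : p %| fib n -> ~~ (p %| fib n.+1).
Proof.
elim: n => [_|n IHn pF]; first by rewrite Euclid_dvd1.
by rewrite fibSS dvdn_addr //; apply: contraTN pF => /IHn.
Qed.

(** The addition formula gives F(g(k+1)) = F(g) (F(gk+1) + F(g-1) q) when F(gk) = F(g) q, and F(g-1)
    = F(g+1) mod p. The congruence for q carries an extra factor F(g+1), which avoids the exponent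
    k-1 at k = 0. *)
Lemma fib_mul_quotient g k : 0 < g -> p %| fib g ->
  exists q, [/\ fib (g * k) = fib g * q,
    ((q%:R : 'F_p) * (fib g.+1)%:R = k%:R * (fib g.+1)%:R ^+ k)%R &
    ((fib (g * k).+1)%:R = (fib g.+1)%:R ^+ k :> 'F_p)%R].
Proof.
case: g => // g _ pFg.
have Fg0 : ((fib g.+1)%:R = 0 :> 'F_p)%R by apply/eqP; rewrite natFp0.
have FgE : ((fib g)%:R = (fib g.+2)%:R :> 'F_p)%R.
  by rewrite fibSS natrD Fg0 add0r.
elim: k => [|k [q [Fq qE FkE]]].
  by exists 0; rewrite muln0 /= muln0 !mul0r expr0.
exists (fib (g.+1 * k).+1 + fib g * q); rewrite mulnS; split.
- rewrite addSn fib_addS Fq; ring.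
- rewrite natrD natrM FkE FgE mulrDl -mulrA qE exprS -natr1; ring.
- by rewrite fib_addS natrD !natrM Fg0 FkE mul0r addr0 exprS.
Qed.

Lemma dvdn_fib_mul g k : 0 < g -> p %| fib g -> p %| fib (g * k).
Proof.
move=> g0 pF; have [q [-> _ _]] := fib_mul_quotient k g0 pF.
exact: dvdn_mulr.
Qed.

Lemma logn_fib_mul g k : 0 < g -> p %| fib g -> ~~ (p %| k) ->
  logn p (fib (g * k)) = logn p (fib g).
Proof.
move=> g0 pF pk; have [q [-> qE _]] := fib_mul_quotient k g0 pF.
have pq : ~~ (p %| q).
  apply: contra pk; rewrite -!natFp0 => /eqP q0; move/eqP: qE.
  rewrite q0 mul0r eq_sym mulf_eq0 => /orP[//|].
  by rewrite expf_eq0 (natFp0 (fib g.+1)) (negPf (dvdn_fibS pF)) andbF.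
have q0 : 0 < q by case: q pq {qE} => //; rewrite dvdn0.
rewrite lognM ?fib_gt0 // (_ : logn p q = 0) ?addn0 //.
by apply: logn_coprime; rewrite prime_coprime.
Qed.

(** With Bezout um = vn + d, F(um) = F(vn+1) F(d) + F(vn) F(d-1); p divides F(um) and F(vn), but not
    F(vn+1). *)
Lemma dvdn_fib_gcd m n : 0 < m -> 0 < n ->
  p %| fib m -> p %| fib n -> p %| fib (gcdn m n).
Proof.
move=> m0 n0 pm pn; case: (egcdnP n m0) => u v uE _.
have g0 : 0 < gcdn m n by rewrite gcdn_gt0 m0.
have pv : p %| fib (v * n) by rewrite mulnC dvdn_fib_mul.
have: p %| fib (u * m) by rewrite mulnC dvdn_fib_mul.
rewrite uE; case: (gcdn m n) g0 => // d _.
rewrite addnS fib_addS (dvdn_addl _ (dvdn_mulr _ pv)) Euclid_dvdM //.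
by rewrite (negPf (dvdn_fibS pv)).
Qed.

Lemma fib_period_double g : 0 < g -> ~~ odd g -> p %| fib g ->
  fib_period p (g + g).
Proof.
move=> g0 g_even pF; split=> [|n]; first by rewrite addn_gt0 g0.
have F0 : ((fib g)%:R = 0 :> 'F_p)%R by apply/eqP; rewrite natFp0.
have F2 : ((fib (g + g))%:R = 0 :> 'F_p)%R by rewrite fib_double natrM F0 mul0r.
(* As g is even, Cassini's identity modulo p reads F(g+1)^2 = 1. *)
have F1 : ((fib (g + g).+1)%:R = 1 :> 'F_p)%R.
  have := fib_cassini 'F_p g; rewrite F0 -signr_odd (negPf g_even) expr0 => e.
  by rewrite -[RHS]e fib_addS natrD !natrM F0; ring.
suff /(congr1 val) : ((fib (n + (g + g)))%:R = (fib n)%:R :> 'F_p)%R.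
  by rewrite /= !val_Fp_nat.
case: n => [|n]; first by rewrite add0n F2.
by rewrite addSn fib_addS natrD !natrM F2 F1 mulr0 addr0 mulr1.
Qed.

End FibModulo.

Lemma mod5_prime p : prime p -> p != 5 -> p %% 5 \in [:: 1; 2; 3; 4].
Proof.
move=> p_prime p5; have: p %% 5 != 0.
  by rewrite -/(5 %| p) dvdn_prime2 // eq_sym.
have: p %% 5 < 5 by rewrite ltn_mod.
by case: (p %% 5) => [|[|[|[|[|]]]]].
Qed.

Lemma sub_epsilon p : prime p -> p != 5 ->
  `|(p%:Z - epsilon p)%R|%N = if p %% 5 \in [:: 1; 4] then p.-1 else p.+1.
Proof.
move=> p_prime p5; have p_gt0 := prime_gt0 p_prime.
have := mod5_prime p_prime p5; rewrite /epsilon.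
by case: (p %% 5) => [|[|[|[|[|]]]]] //= _; lia.
Qed.

(** * Divisibility of F(p - epsilon) by p *)

Section FibApparition.

Local Open Scope ring_scope.

Lemma fib_binet (R : comPzRingType) (a b : R) n :
  a + b = 1 -> a * b = - 1 -> (a - b) * (fib n)%:R = a ^+ n - b ^+ n.
Proof.
move=> sab pab.
suff: (a - b) * (fib n)%:R = a ^+ n - b ^+ n
   /\ (a - b) * (fib n.+1)%:R = a ^+ n.+1 - b ^+ n.+1 by case.
elim: n => [|n [IH1 IH2]]; first by rewrite !expr0 !expr1 /=; split; ring.
split=> //; rewrite fibSS natrD mulrDr IH1 IH2.
have -> : a ^+ n.+2 - b ^+ n.+2
  = (a + b) * (a ^+ n.+1 - b ^+ n.+1) - a * b * (a ^+ n - b ^+ n).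
  by rewrite !exprS; ring.
by rewrite sab pab; ring.
Qed.

(** By Fermat 5 divides p^4 - 1, the order of the unit group of a field with p^4 elements, so
    Cauchy's theorem yields an element of order 5. *)
Lemma exists_fifth_root_unity (p : nat) : prime p -> p != 5%N ->
  exists (F : finFieldType) (z : F),
    p \in [pchar F] /\ 1 + z + z ^+ 2 + z ^+ 3 + z ^+ 4 = 0.
Proof.
move=> p_prime p5.
have [F chF cardF] := pPrimePowerField p_prime (isT : 0 < 4)%N.
have : (5 %| #|[set: {unit F}]|)%N.
  rewrite card_finField_unit cardF -subn1 -eqn_mod_dvd ?expn_gt0 ?prime_gt0 //.
  rewrite -modnXm; have := mod5_prime p_prime p5.
  by case: (p %% 5)%N => [|[|[|[|[|]]]]].
case/Cauchy => // u _ ou; exists F, (val u); split=> //.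
have u5 : val u ^+ 5 = 1 by rewrite -FinRing.val_unitX -ou expg_order.
have u1 : val u - 1 != 0.
  rewrite subr_eq0; apply/eqP => u1.
  have uE : u = 1%g by apply: val_inj.
  by move: ou; rewrite uE order1.
apply: (mulfI u1); rewrite mulr0.
transitivity (val u ^+ 5 - 1); first by ring.
by rewrite u5 subrr.
Qed.

Lemma dvdn_fib_sub_epsilon (p : nat) : prime p -> p != 5%N ->
  (p %| fib `|(p%:Z - epsilon p)%R|)%N.
Proof.
move=> p_prime p5.
have [F [z [chF zE]]] := exists_fifth_root_unity p_prime p5.
have z5 : z ^+ 5 = 1.
  have: (z - 1) * (1 + z + z ^+ 2 + z ^+ 3 + z ^+ 4) = 0 by rewrite zE mulr0.
  by move=> e; apply/eqP; rewrite -subr_eq0 -e; apply/eqP; ring.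
pose a := - (z + z ^+ 4); pose b := - (z ^+ 2 + z ^+ 3).
have sab : a + b = 1.
  by rewrite -[RHS]subr0 -zE /a /b; ring.
have pab : a * b = - 1.
  have -> : a * b = z ^+ 3 + z ^+ 4 + z ^+ 5 * (z + z ^+ 2).
    by rewrite /a /b; ring.
  by rewrite z5 -[RHS]add0r -zE; ring.
have ab2 : (a - b) ^+ 2 = 5%:R.
  have -> : (a - b) ^+ 2 = (a + b) ^+ 2 - 4%:R * (a * b) by ring.
  by rewrite sab pab; ring.
(* This allows cancelling a - b in Binet's formula. *)
have ab0 : a - b != 0.
  rewrite -sqrf_eq0 ab2 -(dvdn_pcharf chF) dvdn_prime2 //.
have frob (x y : F) : (x + y) ^+ p = x ^+ p + y ^+ p.
  by rewrite -!(pFrobenius_autE chF) rmorphD.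
have frobN (x : F) : (- x) ^+ p = - x ^+ p.
  by rewrite -!(pFrobenius_autE chF) rmorphN.
(* Exponents of z count modulo 5 only, so p mod 5 determines the action of Frobenius. *)
have zp k : (z ^+ k) ^+ p = z ^+ ((k * (p %% 5)) %% 5).
  by rewrite -exprM modnMmr expr_mod.
have ap : a ^+ p = - (z ^+ ((1 * (p %% 5)) %% 5) + z ^+ ((4 * (p %% 5)) %% 5)).
  by rewrite frobN frob -[z in z ^+ p]expr1 !zp.
have bp : b ^+ p = - (z ^+ ((2 * (p %% 5)) %% 5) + z ^+ ((3 * (p %% 5)) %% 5)).
  by rewrite frobN frob !zp.
have [a0 b0] : a != 0 /\ b != 0.
  by apply/andP; rewrite -negb_or -mulf_eq0 pab oppr_eq0 oner_eq0.
have p1 : p.-1.+1 = p by rewrite prednK ?prime_gt0.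
have expf_fix (x : F) : x != 0 -> x ^+ p = x -> x ^+ p.-1 = 1.
  by move=> x0 xE; apply: (mulfI x0); rewrite mulr1 -exprS p1.
have frob_fix : a ^+ p = a -> b ^+ p = b -> a ^+ p.-1 - b ^+ p.-1 = 0.
  by move=> aE bE; rewrite (expf_fix a) // (expf_fix b) // subrr.
(* If the roots are exchanged, both powers equal ab. *)
have frob_swap : a ^+ p = b -> b ^+ p = a -> a ^+ p.+1 - b ^+ p.+1 = 0.
  by move=> aE bE; rewrite !exprS aE bE mulrC subrr.
rewrite (dvdn_pcharf chF); apply/eqP/(mulfI ab0); rewrite mulr0.
rewrite (fib_binet _ sab pab) sub_epsilon //.
have := mod5_prime p_prime p5.
move: ap bp; case: (p %% 5)%N => [|[|[|[|[|]]]]] //= ap bp _.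
- exact: frob_fix.
- by apply: frob_swap; rewrite ?ap ?bp // addrC.
- by apply: frob_swap; rewrite ?ap ?bp // addrC.
- by apply: frob_fix; rewrite ?ap ?bp // addrC.
Qed.

End FibApparition.

(** * Comparison of the two absolute values *)

Lemma padic_abs_nat p n : 0 < n ->
  padic_abs p n%:R%R = (p%:R ^ (- (logn p n)%:Z))%R.
Proof.
move=> n0; rewrite /padic_abs Num.Theory.pnatr_eq0 eqn0Ngt n0 /=.
by rewrite -[(n%:R)%R]/((n%:Z)%:~R)%R numq_int denq_int logn1 sub0r.
Qed.

Theorem theorem14 (p i : nat) (p_prime : prime p)
    (p_neq2 : p <> 2) (p_neq3 : p <> 3) (p_neq5 : p <> 5)
    (i_zero : lucas_zero p i) :
  padic_abs p ((lucas i)%:R)%R =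
  padic_abs p ((fib `|(p%:Z - epsilon p)%R|%N)%:R)%R.
Proof.
have [m [[_ m_min] i_lt /eqP]] := i_zero.
rewrite mod0n -/(p %| lucas i) => pL.
have p_gt3 : 3 < p by have := prime_gt1 p_prime; lia.
have p_odd : odd p by case: (even_prime p_prime).
have i_gt0 : 0 < i.
  by case: i pL {i_lt i_zero} => // /dvdn_leq => /(_ isT) /=; lia.
have p5 := introN eqP p_neq5.
have pN := dvdn_fib_sub_epsilon p_prime p5.
set N := `|_|%N in pN *.
have [N_gt0 N_even pN'] : [/\ 0 < N, ~~ odd N & ~~ (p %| N)].
  have [NE|NE] : N = p.-1 \/ N = p.+1.
    by rewrite /N sub_epsilon //; case: ifP; [left|right].
  - rewrite NE gtnNdvd; [split=> //; lia|lia|lia].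
  - rewrite NE /= p_odd; split=> //.
    by rewrite -addn1 dvdn_addr // Euclid_dvd1.
(* Otherwise p divides L(i) + F(i) = 2 F(i+1), hence 2, as consecutive Fibonacci numbers are not
   both divisible by p. *)
have pFi : ~~ (p %| fib i).
  apply/negP => pF; have := dvdn_add pL pF.
  rewrite lucas_add_fib Euclid_dvdM // (negPf (dvdn_fibS p_prime pF)) orbF.
  by move/dvdn_leq => /(_ isT); lia.
have Li_gt0 : 0 < lucas i.
  by have := fib_gt0 (ltn_addr i i_gt0); rewrite fib_double muln_gt0 => /andP[].
have logL : logn p (lucas i) = logn p (fib (i + i)).
  by rewrite fib_double lognM ?fib_gt0 // (@logn_coprime _ (fib i)) // prime_coprime.
have ii_gt0 : 0 < i + i by rewrite addn_gt0 i_gt0.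
have pF2i : p %| fib (i + i) by rewrite fib_double dvdn_mull.
have pFg := dvdn_fib_gcd p_prime ii_gt0 N_gt0 pF2i pN.
set g := gcdn _ _ in pFg.
have g_gt0 : 0 < g by rewrite gcdn_gt0 ii_gt0.
have g_even : ~~ odd g.
  by rewrite -dvdn2 dvdn_gcd !dvdn2 addnn odd_double.
have m_le := m_min _ (fib_period_double p_prime g_gt0 g_even pFg).
have [k kE] := dvdnP (dvdn_gcdl (i + i) N); rewrite -/g in kE.
have [l lE] := dvdnP (dvdn_gcdr (i + i) N); rewrite -/g in lE.
have k_gt0 : 0 < k by move: ii_gt0; rewrite kE muln_gt0 => /andP[].
(* From i < m <= 2g follows kg = 2i < 4g; then k <= 3 < p. *)
have k_lt4 : k < 4.
  rewrite -(ltn_pmul2r g_gt0) -kE (_ : 4 * g = (g + g) + (g + g)); last by ring.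
  by have i_lt2g := leq_trans i_lt m_le; rewrite -addSn leq_add // ltnW.
have pk : ~~ (p %| k) by rewrite gtnNdvd // (leq_trans k_lt4).
have pl : ~~ (p %| l) by apply: contra pN'; rewrite lE => /dvdn_mulr.
rewrite !padic_abs_nat ?fib_gt0 // logL kE lE ![_ * g]mulnC.
by rewrite !logn_fib_mul.
Qed.
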